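(* $\mathrm{Ba}(C_p(2^{\omega_1}))=\mathrm{Bo}(C(2^{\omega_1}))$.
   Context: $\omega_1$ is the first uncountable ordinal, and $2^{\omega_1}=\{0,1\}^{\omega_1}$ is the Cantor cube with the product topology. $C(2^{\omega_1})$ is the Banach space of continuous real-valued functions on it with the supremum norm, and $C_p(2^{\omega_1})$ is the same set equipped with the pointwise convergence topology. For a topological space $T$, $\mathrm{Bo}(T)$ is the Borel $\sigma$-algebra generated by the open sets and $\mathrm{Ba}(T)$ is the Baire $\sigma$-algebra generated by all continuous real-valued functions on $T$; $\mathrm{Bo}(C(2^{\omega_1}))$ refers to the norm topology. It is well known that, for $K$ compact Hausdorff, $\mathrm{Ba}(C_p(K))$ is the $\sigma$-algebra generated by the evaluations $\delta_t$, $t\in K$. *)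

(* Defs.v *)
From HB Require Import structures.
From mathcomp Require Import all_boot all_order all_algebra.
From mathcomp Require Import all_classical all_reals all_analysis.
From mathcomp Require wochoice.

Set Implicit Arguments.
Unset Strict Implicit.
Unset Printing Implicit Defensive.

Import Order.TTheory GRing.Theory Num.Theory.
Import numFieldNormedType.Exports.

Local Open Scope classical_set_scope.
Local Open Scope ring_scope.

(* [(T, le)] is a well-ordered set of order type omega_1: [T] is uncountable,
   whereas the initial segment strictly below any element is countable.
   [well_order] entails that [le] is a total order. *)
Definition is_omega1 (T : eqType) (le : rel T) : Prop :=
  [/\ wochoice.well_order le,
      ~ countable [set: T] &
      forall x : T, countable [set y | le y x /\ y <> x]].

Section omega1_exists.

Let uncountable_set_nat : ~ countable [set: set nat].
Proof.
move=> /countable_injP[f finj].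
pose D : set nat := [set n | exists2 A : set nat, f A = n & ~ A n].
have fD A : f A = f D -> A = D by move=> /finj; apply; rewrite inE.
have [DD|nDD] := pselect (D (f D)); last by apply: (nDD); exists D.
by have [A /fD ->] := DD.
Qed.

Lemma omega1_exists : exists (T : choiceType) (le : rel T), is_omega1 le.
Proof.
have [le wo] := wochoice.well_ordering_principle (set nat).
have anti : antisymmetric le.
  have wo' : wochoice.wo_chain le predT by move=> A _; exact: wo.
  by move=> x y; apply: (wochoice.wo_chain_antisymmetric wo').
pose seg x := [set y | le y x /\ y <> x].
pose T : choiceType := {x : set nat | countable (seg x)}.
exists T, (fun x y => le (val x) (val y)); split.
- apply: wochoice.antisymmetric_well_order.
    by move=> x y /anti /val_inj.
  move=> A [a Aa].
  have [|z [[zA zmin] _]] :=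
    wo [pred x | `[< exists2 u : T, u \in A & val u = x >]].
    by exists (val a); apply/asboolP; exists a.
  move: zA => /asboolP[u uA uz].
  exists u; split => // v vA; rewrite uz; apply: zmin.
  by apply/asboolP; exists v.
- move=> cT.
  have cA : countable [set x | countable (seg x)].
    rewrite (_ : [set x | _] = (val : T -> set nat) @` setT).
      by apply: sub_countable cT; exact: card_image_le.
    by apply/seteqP; split=> [x /= cx|_ [x _ <-]]; [exists (exist _ x cx)|exact: (svalP x)].
  have [|z [[zN zmin] _]] := wo [pred x | ~~ countable (seg x)].
    apply: contrapT => noN; apply: uncountable_set_nat.
    apply: sub_countable cA; apply: subset_card_le => x _ /=.
    by apply: contrapT => /negP ncx; apply: noN; exists x.
  move: (zN); rewrite inE => /negP; apply.
  apply: sub_countable cA; apply: subset_card_le => y [yz /= yNz].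
  apply: contrapT => /negP ncy; apply: yNz; apply: anti.
  by rewrite yz /=; apply: zmin.
- move=> x; have /countable_injP[f finj] := svalP x.
  apply/countable_injP; exists (f \o val) => u v.
  rewrite !inE /= => -[ux uNx] [vx vNx] /finj uv; apply: val_inj; apply: uv.
    by rewrite inE; split => // /val_inj.
  by rewrite inE; split => // /val_inj.
Qed.

End omega1_exists.

Definition cantor_cube (T : Type) : Type := prod_topology (fun _ : T => bool).

HB.instance Definition _ (T : Type) := Topological.on (cantor_cube T).

Lemma cantor_cube_compact (T : eqType) : compact [set: cantor_cube T].
Proof.
have := @tychonoff T (fun _ => bool) _ (fun=> bool_compact).
by congr (compact _); rewrite eqEsubset.
Qed.

(* The Banach space C(K). Compactness is a parameter of the type because the
   sup norm is a norm on bounded functions only. *)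
Definition Cnorm (R : realType) (K : topologicalType)
  (cK : compact [set: K]) : Type := continuousType K R.

Section Cnorm_instances.
Variables (R : realType) (K : topologicalType) (cK : compact [set: K]).
Local Notation V := (Cnorm R cK).
Implicit Types f g h : V.

HB.instance Definition _ := Choice.copy V (continuousType K R).

Definition Cnorm_fun f : K -> R := (f : continuousType K R).
Local Notation fn := Cnorm_fun.

Lemma Cnorm_cont f : continuous (fn f).
Proof. exact: (@cts_fun K R f). Qed.

Lemma CnormP f g : fn f =1 fn g -> f = g.
Proof. by move=> fg; apply/(@continuousEP K R). Qed.

Definition Cnorm_mk (u : K -> R) (cu : continuous u) : V := mkcts cu.

Definition Cnorm_zero : V := Cnorm_mk (fun x => @cst_continuous K R 0 x).

Let add_cont f g : continuous (fun x => fn f x + fn g x).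
Proof. by move=> x; apply: cvgD; exact: Cnorm_cont. Qed.

Let opp_cont f : continuous (fun x => - fn f x).
Proof. by move=> x; apply: cvgN; exact: Cnorm_cont. Qed.

Let scale_cont (a : R) f : continuous (fun x => a * fn f x).
Proof. by move=> x; apply: cvgM; [exact: cvg_cst|exact: Cnorm_cont]. Qed.

Definition Cnorm_add f g : V := Cnorm_mk (@add_cont f g).
Definition Cnorm_opp f : V := Cnorm_mk (@opp_cont f).
Definition Cnorm_scale (a : R) f : V := Cnorm_mk (@scale_cont a f).

Let addA : associative Cnorm_add.
Proof. by move=> f g h; apply: CnormP => x; exact: addrA. Qed.
Let addC : commutative Cnorm_add.
Proof. by move=> f g; apply: CnormP => x; exact: addrC. Qed.
Let add0 : left_id Cnorm_zero Cnorm_add.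
Proof. by move=> f; apply: CnormP => x; exact: add0r. Qed.
Let addN : left_inverse Cnorm_zero Cnorm_opp Cnorm_add.
Proof. by move=> f; apply: CnormP => x; exact: addNr. Qed.

HB.instance Definition _ := GRing.isZmodule.Build V addA addC add0 addN.

Let scaleA a b f : Cnorm_scale a (Cnorm_scale b f) = Cnorm_scale (a * b) f.
Proof. by apply: CnormP => x; exact: mulrA. Qed.
Let scale1 : left_id 1 Cnorm_scale.
Proof. by move=> f; apply: CnormP => x; exact: mul1r. Qed.
Let scaleDr : right_distributive Cnorm_scale +%R.
Proof. by move=> a f g; apply: CnormP => x; exact: mulrDr. Qed.
Let scaleDl f : {morph Cnorm_scale^~ f : a b / a + b}.
Proof. by move=> a b; apply: CnormP => x; exact: mulrDl. Qed.

HB.instance Definition _ :=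
  GRing.Zmodule_isLmodule.Build R V scaleA scale1 scaleDr scaleDl.

Definition sup_norm f : R := sup [set `|fn f x| | x in [set: K]].

Lemma le_sup_norm f x : `|fn f x| <= sup_norm f.
Proof.
apply: ub_le_sup; last by exists x.
have /compact_bounded [M [_ Mf]] : compact (fn f @` setT).
  apply: continuous_compact cK; apply: continuous_subspaceT.
  exact: Cnorm_cont.
exists (M + 1) => _ [y _ <-]; apply: (Mf (M + 1)); first by rewrite ltrDl.
by exists y.
Qed.

Lemma sup_norm_le f (M : R) :
  0 <= M -> (forall x, `|fn f x| <= M) -> sup_norm f <= M.
Proof.
move=> M0 fM; rewrite /sup_norm; set S := [set _ | _ in _].
have [->|/set0P S0] := eqVneq S set0; first by rewrite sup0.
by apply: ge_sup => // _ [x _ <-].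
Qed.

Let sup_norm_ge0 f : 0 <= sup_norm f.
Proof.
have [[x _]|K0] := pselect (exists x : K, True).
  by apply: le_trans (le_sup_norm f x); exact: normr_ge0.
rewrite /sup_norm (_ : [set _ | _ in _] = set0) ?sup0//.
by apply/seteqP; split=> // y [x _ _]; case: K0; exists x.
Qed.

Let sup_normD f g : sup_norm (f + g) <= sup_norm f + sup_norm g.
Proof.
apply: sup_norm_le => [|x]; first exact: addr_ge0.
by rewrite (le_trans (ler_normD _ _))// lerD// le_sup_norm.
Qed.

Let sup_norm0_eq0 f : sup_norm f = 0 -> f = 0.
Proof.
move=> f0; apply: CnormP => x; apply/eqP.
by rewrite -normr_le0 -f0 le_sup_norm.
Qed.

Let sup_normZ_le (a : R) f : sup_norm (a *: f) <= `|a| * sup_norm f.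
Proof.
apply: sup_norm_le => [|x]; first exact: mulr_ge0.
by rewrite [fn _ x](_ : _ = a * fn f x)// normrM ler_wpM2l// le_sup_norm.
Qed.

Let sup_normZ (a : R) f : sup_norm (a *: f) = `|a| * sup_norm f.
Proof.
apply/eqP; rewrite eq_le sup_normZ_le /=.
have [->|a0] := eqVneq a 0; first by rewrite normr0 mul0r.
rewrite -ler_pdivlMl ?normr_gt0// -normfV.
by rewrite -{1}[f](@scalerK _ _ a) ?unitfE.
Qed.

HB.instance Definition _ :=
  Lmodule_isNormed.Build R V sup_normD sup_normZ sup_norm0_eq0.

Lemma Cnorm_normE f : `|f| = sup [set `|fn f x| | x in [set: K]].
Proof. by []. Qed.

End Cnorm_instances.

Definition Cptws (R : realType) (K : topologicalType) : Type :=
  initial_topology (id : continuousType K R -> {ptws K -> R}).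

HB.instance Definition _ (R : realType) (K : topologicalType) :=
  Topological.on (Cptws R K).

Definition borel_sigma (T : topologicalType) : set (set T) := <<s open >>.

Definition baire_sigma (R : realType) (T : topologicalType) : set (set T) :=
  <<s \bigcup_(f in [set f : T -> R | continuous f])
        preimage_set_system setT f measurable >>.

Arguments borel_sigma : clear implicits.
Arguments baire_sigma : clear implicits.

(* Main.v *)
Require Import Defs.
From mathcomp Require Import all_boot all_order all_algebra.
From mathcomp Require Import all_classical all_reals all_analysis.
From mathcomp Require wochoice.
From mathcomp Require Import ring lra.
Import numFieldNormedType.Exports.

(** For [e > 0] the set [active e f] of coordinates on which [f] depends by more
    than [e] is finite, and it meets [B] iff there is a margin [d > 0] such that,
    for every dyadic partition of omega_1 (seen as a set of reals), [f] oscillates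
    by more than [e + d] in the directions of some piece of [B]; by separability
    of the cube this is a countable combination of conditions on evaluations of
    [f]. By Kunen's argument every property of the finite set [active e f] is then measurable.
    As [e] tends to [0], [f] is uniformly approximated by functions of the
    coordinates in [active e f], and up to rational approximation these are
    described by that set together with countably many parameters. Hence a
    norm-open set is a countable union of sets given by a condition on
    [active e f] and countably many inequalities between evaluations. *)

Set Implicit Arguments.
Unset Strict Implicit.
Unset Printing Implicit Defensive.

Import Order.TTheory GRing.Theory Num.Theory.
Local Open Scope classical_set_scope.
Local Open Scope ring_scope.

(** * Closure of a sigma-algebra under countable logical operations *)

Section sigma_algebra_pred.
Context (X : Type) (S : set (set X)) (sS : sigma_algebra setT S).
Implicit Types P Q : X -> Prop.

Lemma sigma_algebra_not P : S [set x | P x] -> S [set x | ~ P x].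
Proof. by case: sS => _ sD _ /sD; rewrite setTD. Qed.

Lemma sigma_algebra_ex (I : countType) (P : I -> X -> Prop) :
  (forall i, S [set x | P i x]) -> S [set x | exists i, P i x].
Proof.
case: sS => s0 _ sU SP.
rewrite (_ : mkset _ =
    \bigcup_n if unpickle n is Some i then [set x | P i x] else set0).
  by apply: sU => n; case: (unpickle n).
apply/seteqP; split=> [x [i Pix]|x [n _]].
  by exists (pickle i) => //; rewrite pickleK.
by case: (unpickle n) => // i Pix; exists i.
Qed.

Lemma sigma_algebra_all (I : countType) (P : I -> X -> Prop) :
  (forall i, S [set x | P i x]) -> S [set x | forall i, P i x].
Proof.
move=> SP; rewrite (_ : mkset _ = [set x | ~ exists i, ~ P i x]).
  by apply/sigma_algebra_not/sigma_algebra_ex => i; exact: sigma_algebra_not.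
by apply/seteqP; split=> x /= => [Px [i]|/forallNP Px i]; [|exact: contrapT].
Qed.

Lemma sigma_algebra_and P Q :
  S [set x | P x] -> S [set x | Q x] -> S [set x | P x /\ Q x].
Proof.
move=> SP SQ; rewrite (_ : mkset _ =
    [set x | forall b : bool, if b then P x else Q x]).
  by apply: sigma_algebra_all => -[].
apply/seteqP; split=> x /= => [[? ?] []|Px]//.
by split; [have := Px true|have := Px false].
Qed.

Lemma sigma_algebra_cst (p : Prop) : S [set x | p].
Proof.
have S0 : S [set x | False] by case: sS.
have [hp|hp] := pselect p; last first.
  by rewrite (_ : mkset _ = [set x | False])//; apply/seteqP; split=> x /=.
rewrite (_ : mkset _ = [set x | ~ False]); first exact: sigma_algebra_not.
by apply/seteqP; split=> x /= _; [move=> []|exact: hp].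
Qed.

Lemma sigma_algebra_imply P Q :
  S [set x | P x] -> S [set x | Q x] -> S [set x | P x -> Q x].
Proof.
move=> SP SQ; rewrite (_ : mkset _ = [set x | ~ (P x /\ ~ Q x)]).
  by apply/sigma_algebra_not/sigma_algebra_and => //; exact: sigma_algebra_not.
apply/seteqP; split=> x /= => [PQ [/PQ]|PQ Px]//.
by apply: contrapT => nQ; apply: PQ.
Qed.

Lemma sigma_algebra_iff P Q :
  S [set x | P x] -> S [set x | Q x] -> S [set x | P x <-> Q x].
Proof.
by move=> SP SQ; apply: sigma_algebra_and; exact: sigma_algebra_imply.
Qed.

End sigma_algebra_pred.

(** * Order of omega_1 and its embedding into the reals *)

Section omega1.
Context (T : eqType) (le : rel T) (omega1_T : is_omega1 le).

Lemma omega1_min (P : set T) : P !=set0 ->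
  exists2 z, P z & forall x, P x -> le z x.
Proof.
case: omega1_T => wo _ _ [x Px].
have [|z [[zP zmin] _]] := wo [pred x | `[< P x >]].
  by exists x; apply/asboolP.
by exists z => [|y Py]; [apply/asboolP|apply: zmin; apply/asboolP].
Qed.

Lemma omega1_total : total le.
Proof.
case: omega1_T => wo _ _ x y.
have wo' : wochoice.wo_chain le predT by move=> A _; exact: wo.
by apply: (wochoice.wo_chainW wo').
Qed.

Lemma omega1_anti : antisymmetric le.
Proof.
case: omega1_T => wo _ _.
have wo' : wochoice.wo_chain le predT by move=> A _; exact: wo.
by move=> x y; apply: (wochoice.wo_chain_antisymmetric wo').
Qed.

Lemma omega1_trans : transitive le.
Proof.
move=> y x z xy yz.
have [w [->|[->|->]] wmin] : exists2 w, w = x \/ w = y \/ w = z &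
    forall v, v = x \/ v = y \/ v = z -> le w v.
- by apply: (@omega1_min [set w | w = x \/ w = y \/ w = z]); exists x; left.
- by apply: wmin; right; right.
- have yx : le y x by apply: wmin; left.
  by rewrite (@omega1_anti x y)// xy.
- have zy : le z y by apply: wmin; right; left.
  by rewrite -(@omega1_anti y z)// yz.
Qed.

Lemma omega1_max (s : seq T) x : x \in s ->
  exists2 z, z \in s & forall y, y \in s -> le y z.
Proof.
have refl u : le u u by have := omega1_total u u; rewrite orbb.
elim: s x => // a [|b s] IH x _.
  by exists a => [|y]; rewrite inE// => /eqP ->.
have [z zs zmax] := IH b (mem_head _ _).
have [az|za] := orP (omega1_total a z).
  exists z => [|y]; first by rewrite in_cons zs orbT.
  by rewrite in_cons => /predU1P[->//|]; exact: zmax.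
exists a => [|y]; first by rewrite mem_head.
by rewrite in_cons => /predU1P[->//|/zmax yz]; exact: omega1_trans za.
Qed.

Lemma omega1_enum : exists g : T -> nat -> T,
  forall a b, le b a -> exists n, g a n = b.
Proof.
case: omega1_T => _ _ cseg.
suff /choice[g gP] : forall a, exists f : nat -> T,
  forall b, le b a -> exists n, f n = b by exists g.
move=> a; have /countable_injP[e einj] := cseg a.
pose Q n b := [/\ le b a, b <> a & e b = n].
(* Index 0 lists [a] itself, which the strict segment omits; [a] also serves as the default for
   codes that are not attained. *)
exists (fun n => if n is m.+1 then
    if pselect (exists b, Q m b) is left ex then projT1 (cid ex) else a
  else a) => b ba.
have [->|/eqP bna] := eqVneq b a; first by exists 0%N.
exists (e b).+1; case: pselect => [ex|]; last by case; exists b.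
by have [ca cna /einj] := projT2 (cid ex); apply; rewrite inE.
Qed.

(* Each element is coded by the isomorphism type of its initial segment,
   transported to [nat] along an injection; two distinct ordinals have
   non-isomorphic initial segments. *)
Lemma omega1_reals : exists h : T -> nat -> bool, injective h.
Proof.
case: (omega1_T) => _ _ cseg.
have /choice[e einj] : forall a, exists e : T -> nat,
    {in [set y | le y a /\ y <> a] &, injective e}.
  by move=> a; have /countable_injP[e] := cseg a; exists e.
pose rep a m n := exists x y, [/\ le x a, x <> a & e a x = m] /\
  [/\ le y a, y <> a, e a y = n & le x y].
exists (fun a k =>
  if unpickle k is Some (m, n) then `[< rep a m n >] else false).
move=> a b.
wlog ab : a b / le a b => [wl|] hab.
  by have [/wl|/wl ba] := orP (omega1_total a b); [exact|apply/esym/ba].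
have {}hab m n : rep a m n <-> rep b m n.
  have := congr1 (fun f => f (pickle (m, n))) hab; rewrite /= pickleK => E.
  by split=> r; apply/asboolP; [rewrite -E|rewrite E]; apply/asboolP.
apply: contrapT => anb.
have refl u : le u u by have := omega1_total u u; rewrite orbb.
(* The diagonal of [rep] records which codes occur, so every [x] below [b] has a partner below [a]
   with the same code. *)
have phi x : le x b -> x <> b -> exists y, [/\ le y a, y <> a & e a y = e b x].
  move=> xb xnb; have [_] := hab (e b x) (e b x).
  by case=> [|y [_ [[ya yna eay] _]]]; [exists x, x|exists y].
(* [z] is the least point below [b] whose partner [y] lies strictly below it; [a] is such a point.
   Since partners preserve order, the partner of [y] lies strictly below [y], which contradicts
   minimality. *)
have [z [zb znb [y [ya yna ezy] [yz ynz]]] zmin] : exists2 z,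
    [/\ le z b, z <> b & exists2 y, [/\ le y a, y <> a & e a y = e b z] &
      le y z /\ y <> z] &
    forall x, [/\ le x b, x <> b &
      exists2 y, [/\ le y a, y <> a & e a y = e b x] & le y x /\ y <> x] ->
      le z x.
  apply: omega1_min; exists a; split => //.
  by have [y [ya yna eay]] := phi _ ab anb; exists y.
have yb : le y b by apply: omega1_trans ab.
have ynb : y <> b.
  by move=> yb'; apply: anb; apply: omega1_anti; rewrite ab -yb'.
have [w [wa wna eaw]] := phi _ yb ynb.
have [_] := hab (e b y) (e b z); case.
  by exists y, z; split; split.
move=> w' [y' [[w'a w'na eaw'] [y'a y'na eay' w'y']]].
have w'w : w' = w by apply: (einj a); rewrite ?inE ?eaw'.
have y'y : y' = y by apply: (einj a); rewrite ?inE ?eay'.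
rewrite {}w'w {}y'y {w' y' w'a w'na eaw' y'a y'na eay'} in w'y'.
have wny : w <> y.
  move=> wy; apply: ynz; apply: (einj b); rewrite ?inE//.
  by rewrite -eaw -ezy wy.
apply: ynz; apply: omega1_anti; rewrite yz.
by apply: zmin; split => //; exists w.
Qed.

End omega1.

(** * Separation of finite sets by bit prefixes, and Kunen's argument *)

Lemma eventually_all_seq (T : eqType) (P : T -> nat -> Prop) (s : seq T) :
  (forall t, exists N, forall k, (N <= k)%N -> P t k) ->
  exists N, forall k, (N <= k)%N -> forall t, t \in s -> P t k.
Proof.
move=> evP; elim: s => [|t s [N NP]]; first by exists 0%N.
have [M MP] := evP t; exists (maxn M N) => k.
rewrite geq_max => /andP[Mk Nk] u; rewrite in_cons => /predU1P[->|us].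
  exact: MP.
exact: NP.
Qed.

Section prefix.
Context (T : eqType) (h : T -> nat -> bool).

Definition bits k (t : T) : {ffun 'I_k -> bool} := [ffun i : 'I_k => h t i].

Lemma bits_inj_on (s : seq T) : injective h ->
  exists N, forall k, (N <= k)%N -> {in s &, injective (bits k)}.
Proof.
move=> hinj.
have sep t u : exists N, forall k, (N <= k)%N -> bits k t = bits k u -> t = u.
  have [->|/eqP tu] := eqVneq t u; first by exists 0%N.
  have [n hn] : exists n, h t n <> h u n.
    by apply/existsNP => htu; apply: tu; apply: hinj; exact: funext.
  exists n.+1 => k nk /ffunP/(_ (Ordinal nk)).
  by rewrite !ffunE.
have [N NP] := eventually_all_seq s (fun t => eventually_all_seq s (sep t)).
by exists N => k Nk t u ts us; exact: NP.
Qed.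

End prefix.

(* The sigma-algebra on the finite subsets of omega_1 generated by the hitting
   sets [{A | A meets B}] is the full power set; for two-element sets this is
   Kunen's theorem that all subsets of omega_1 x omega_1 lie in the product of
   the power set sigma-algebras. *)
Lemma sigma_algebra_hit (X : Type) (S : set (set X)) (T : eqType) (le : rel T)
    (A : X -> set T) (P : set T -> Prop) :
  sigma_algebra setT S -> is_omega1 le -> (forall x, finite_set (A x)) ->
  (forall B, S [set x | A x `&` B !=set0]) -> S [set x | P (A x)].
Proof.
move=> sS o1 Afin SA.
have [h hinj] := omega1_reals o1; have [g gP] := omega1_enum o1.
pose cyl k (w : {ffun 'I_k -> bool}) : set T := [set t | bits h k t = w].
(* A finite nonempty set with maximum [a] is [F c a] for some [c], since
   all its elements are among the [g a n]. *)
pose F (c : seq nat) a : set T := [set t | exists2 n, n \in c & g a n = t].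
have bitsE t : forall u, (forall k, bits h k t = bits h k u) -> t = u.
  move=> u tu; apply: hinj; apply: funext => n.
  by have /ffunP/(_ ord_max) := tu n.+1; rewrite !ffunE.
(* Through hitting conditions only, [Q] says that [A x] has a single point [a] in the cylinder of
   [w], that [P (F c a)] holds, and that [A x] and [F c a] meet the same cylinders, which forces
   them to be equal. *)
pose Q c k w x :=
  [/\ A x `&` (cyl k w `&` [set a | P (F c a)]) !=set0,
      forall j (u v : {ffun 'I_j -> bool}), u <> v ->
        ~ (A x `&` (cyl k w `&` cyl j u) !=set0 /\
           A x `&` (cyl k w `&` cyl j v) !=set0) &
      forall j (u : {ffun 'I_j -> bool}), A x `&` cyl j u !=set0 <->
        A x `&` (cyl k w `&` [set a | F c a `&` cyl j u !=set0]) !=set0].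
have SQ c k w : S [set x | Q c k w x].
  rewrite (_ : mkset _ = [set x |
      A x `&` (cyl k w `&` [set a | P (F c a)]) !=set0 /\
      ((forall j (u v : {ffun 'I_j -> bool}), u <> v ->
        ~ (A x `&` (cyl k w `&` cyl j u) !=set0 /\
           A x `&` (cyl k w `&` cyl j v) !=set0)) /\
      forall j (u : {ffun 'I_j -> bool}), A x `&` cyl j u !=set0 <->
        A x `&` (cyl k w `&` [set a | F c a `&` cyl j u !=set0]) !=set0)]).
    apply: sigma_algebra_and => //; apply: sigma_algebra_and => //.
      apply: sigma_algebra_all => // j; apply: sigma_algebra_all => // u.
      apply: sigma_algebra_all => // v; apply: sigma_algebra_imply => //.
        exact: sigma_algebra_cst.
      by apply: sigma_algebra_not => //; exact: sigma_algebra_and.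
    apply: sigma_algebra_all => // j; apply: sigma_algebra_all => // u.
    exact: sigma_algebra_iff.
  by apply/seteqP; split=> [x [? ? ?]|x [? [? ?]]]; [split => //; split|split].
have Q_P c k w x : Q c k w x -> P (A x).
  move=> [[a [Aa [aw PF]]] single same].
  have uniqa b : A x b -> cyl k w b -> b = a.
    move=> Ab bw; apply: bitsE => j; apply: contrapT => ba.
    by apply: (single _ _ _ ba); split; [exists b|exists a].
  rewrite (_ : A x = F c a)//; apply: contrapT => /seteqP AF.
  have hit j u : A x `&` cyl j u !=set0 <-> F c a `&` cyl j u !=set0.
    split=> [/same[b [Ab [bw]]]|Fu]; first by rewrite (uniqa b).
    by apply/same; exists a.
  have /finite_seqP[s As] := Afin x.
  (* Prefixes of length [N] separate all points of both finite sets, so meeting the same cylinders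
     of length [N] yields equality. *)
  have [N /(_ _ (leqnn N)) inj] := bits_inj_on (s ++ [seq g a n | n <- c]) hinj.
  have As' b : A x b -> b \in s ++ [seq g a n | n <- c].
    by rewrite As /= mem_cat => ->.
  have Fs b : F c a b -> b \in s ++ [seq g a n | n <- c].
    by move=> [n nc <-]; rewrite mem_cat (map_f (g a) nc) orbT.
  apply: AF; split=> b Hb.
    have [d [Fd db]] : F c a `&` cyl N (bits h N b) !=set0.
      by apply/hit; exists b.
    by rewrite -(inj d b)//; [exact: Fs|exact: As'].
  have [d [Ad db]] : A x `&` cyl N (bits h N b) !=set0.
    by apply/hit; exists b.
  by rewrite -(inj d b)//; [exact: As'|exact: Fs].
rewrite (_ : mkset _ = [set x | (P set0 /\ ~ (A x `&` setT !=set0)) \/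
    exists c k w, Q c k w x]).
  rewrite (_ : mkset _ = [set x | exists b : bool,
      if b then P set0 /\ ~ (A x `&` setT !=set0)
      else exists c k w, Q c k w x]).
    apply: sigma_algebra_ex => // -[].
      apply: sigma_algebra_and => //; first exact: sigma_algebra_cst.
      exact: sigma_algebra_not.
    by do 3!apply: sigma_algebra_ex => // ?.
  apply/seteqP; split=> x /= [].
  - by exists true.
  - by exists false.
  - by case; [left|right].
apply/seteqP; split=> x /= => [PA|[[P0]|[c [k [w]]]]]; last exact: Q_P; last first.
  by rewrite setIT => /set0P/negP/negPn/eqP ->.
have [A0|/set0P[t At]] := eqVneq (A x) set0.
  by left; rewrite -A0 setIT; split => //; rewrite A0 => -[].
right; have /finite_seqP[s As] := Afin x.
have AsE b : A x b = (b \in s) by rewrite As.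
have [|a sa amax] := @omega1_max _ _ o1 s t; first by rewrite -AsE.
have /choice[n nP] : forall b, exists n, b \in s -> g a n = b.
  move=> b; have [bs|] := boolP (b \in s); last by exists 0%N.
  by have [n] := gP _ _ (amax b bs); exists n.
have AF : A x = F [seq n b | b <- s] a.
  apply/seteqP; split=> b; rewrite AsE.
    by move=> bs; exists (n b); [exact: map_f|exact: nP].
  by move=> [_ /mapP[d ds ->]]; rewrite nP// => <-.
have [N /(_ _ (leqnn N)) inj] := bits_inj_on s hinj.
exists [seq n b | b <- s], N, (bits h N a).
have uniqa b : A x b -> cyl N (bits h N a) b -> b = a.
  by rewrite AsE => bs; exact: inj.
split.
- by exists a; split; [rewrite AsE|split => //=; rewrite -AF].
- move=> j u v uv [[b [Ab [/(uniqa _ Ab) -> /= bu]]]].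
  move=> [d [Ad [/(uniqa _ Ad) -> /= dv]]].
  by apply: uv; rewrite -bu -dv.
- move=> j u; split=> [Au|[b [Ab [/(uniqa _ Ab) ->]]]]; last by rewrite /= -AF.
  by exists a; split; [rewrite AsE|split => //=; rewrite -AF].
Qed.

Lemma exists_invS_lt (R : realType) (e : R) : 0 < e -> exists n, n.+1%:R^-1 < e.
Proof.
move=> e0; exists (Num.truncn e^-1).
by rewrite invf_plt ?posrE ?ltr0n// truncnS_gt.
Qed.

(** * Continuous functions on the cube and their active coordinates *)

Section cantor_cube.
Context (R : realType) (T : eqType).
Implicit Types (x y : cantor_cube T) (f : cantor_cube T -> R).

(** The product topology is a supremum of topologies induced by coordinates, so convergence of the
    filter of cylinders is tested one coordinate at a time. *)
Lemma cantor_cube_nbhs x (U : set (cantor_cube T)) : nbhs x U ->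
  exists s : seq T, forall y, {in s, forall t, x t = y t} -> U y.
Proof.
pose G : set_system (cantor_cube T) := filter_from setT
  (fun s : seq T => [set y | {in s, forall t, x t = y t}]).
have FG : Filter G.
  apply: filter_from_filter; first by exists [::].
  move=> s1 s2 _ _; exists (s1 ++ s2) => // y xy.
  by split=> t ts; apply: xy; rewrite mem_cat ts ?orbT.
suff Gx : G --> x by move=> /Gx[s _ sU]; exists s.
apply/cvg_sup => t A [_ [[W oW <-] Wx] WA].
by exists [:: t] => // y xy; apply: WA; rewrite /= -xy ?mem_head.
Qed.

Lemma cantor_cube_cylinder x (s : seq T) :
  nbhs x [set y : cantor_cube T | {in s, forall t, x t = y t}].
Proof.
elim: s => [|t s IH]; first by apply: filterS filterT.
have xt : nbhs x [set y : cantor_cube T | x t = y t].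
  apply: (@proj_continuous T (fun=> bool) t x [set b | x t = b]).
  by apply: open_nbhs_nbhs; split=> //; exact: discrete_open.
apply: filterS2 xt IH => y /= xy xys u.
by rewrite in_cons => /predU1P[->//|]; exact: xys.
Qed.

(** Compactness, in its near-covering form, is applied along the finite sets of coordinates directed
    by inclusion. *)
Lemma cantor_cube_unif f (e : R) : continuous f -> 0 < e ->
  exists s : seq T, forall x y, {in s, forall t, x t = y t} -> `|f x - f y| < e.
Proof.
move=> cf e0.
pose F : set_system (seq T) := filter_from setT
  (fun s : seq T => [set s' : seq T | {subset s <= s'}]).
have FF : Filter F.
  apply: filter_from_filter; first by exists [::].
  move=> s1 s2 _ _; exists (s1 ++ s2) => // s sub.
  by split=> t ts; apply: sub; rewrite mem_cat ts ?orbT.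
have /compact_near_coveringP cK := @cantor_cube_compact T.
have [|s _ sP] := cK _ F (fun s x => forall y, {in s, forall t, x t = y t} ->
    `|f x - f y| < e) FF.
  move=> x _.
  have [s sP] : exists s : seq T, forall y, {in s, forall t, x t = y t} ->
      `|f x - f y| < e / 2.
    apply: cantor_cube_nbhs.
    by have /cvgrPdist_lt/(_ (e / 2)) := cf x; apply; rewrite divr_gt0.
  exists ([set y | {in s, forall t, x t = y t}],
    [set s' : seq T | {subset s <= s'}]) => /=.
    by split; [exact: cantor_cube_cylinder|exists s].
  move=> [x' s'] /= [xx' ss'] y x'y.
  rewrite (_ : f x' - f y = f x - f y - (f x - f x')); last first.
    by rewrite opprB [RHS]addrC addrA subrK.
  rewrite (le_lt_trans (ler_normB _ _))// (splitr e) ltrD ?sP// => t ts.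
  by rewrite xx'// x'y//; exact: ss'.
by exists s => x y xy; exact: (sP s).
Qed.

Definition mix (b : pred T) (y x : cantor_cube T) : cantor_cube T :=
  fun t => if b t then y t else x t.

Definition active (e : R) f : set T :=
  [set t | exists x y, (forall u, u != t -> x u = y u) /\ e < `|f x - f y|].

Lemma active_sub f e (s : seq T) :
  (forall x y, {in s, forall t, x t = y t} -> `|f x - f y| < e) ->
  active e f `<=` [set` s].
Proof.
move=> sP t [x [y [xy]]]; apply: contraPP => /= ts; apply/negP.
rewrite -leNgt ltW// sP// => u us; apply: xy.
by apply/eqP => ut; apply: ts; rewrite -ut.
Qed.

Lemma active_finite f e : continuous f -> 0 < e -> finite_set (active e f).
Proof.
move=> cf e0; have [s sP] := cantor_cube_unif cf e0.
by apply: sub_finite_set (active_sub sP) _; exact: finite_seq.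
Qed.

(** Take [s] controlling [f] up to [e], and a level at which every coordinate of [s] that is ever
    active is already active. Passing from [x] to [y] along [s], one coordinate at a time, then
    leaves [f] unchanged. *)
Lemma active_determines f e : continuous f -> 0 < e -> exists n, forall x y,
  (forall t, active n.+1%:R^-1 f t -> x t = y t) -> `|f x - f y| < e.
Proof.
move=> cf e0; have [s sP] := cantor_cube_unif cf e0.
pose good t n := (exists m, active m.+1%:R^-1 f t) -> active n.+1%:R^-1 f t.
have [|N /(_ _ (leqnn N)) NP] := @eventually_all_seq _ good s.
  move=> t; have [[m mt]|nt] := pselect (exists m, active m.+1%:R^-1 f t).
    exists m => k mk _; have [x [y [xy mxy]]] := mt.
    exists x, y; split=> //; apply: le_lt_trans mxy.
    by rewrite lef_pV2 ?posrE ?ltr0n// ler_nat ltnS.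
  by exists 0%N => k _ /nt.
exists N => x y xy.
have mixE (l : seq T) : {subset l <= s} -> f (mix (mem l) y x) = f x.
  elim: l => [|t l IH] ls; first by [].
  rewrite -IH; last by move=> u ul; apply: ls; rewrite in_cons ul orbT.
  (* If changing [t] altered the value of [f], then [t] would be active at some level, hence at
     level [N], and [x] and [y] would agree there. *)
  apply: contrapT => /eqP; rewrite -subr_eq0 -normr_gt0 => d0.
  have xyt : x t = y t.
    apply: xy; apply: NP; first by apply: ls; exact: mem_head.
    have [m md] := exists_invS_lt d0.
    exists m, (mix (mem (t :: l)) y x), (mix (mem l) y x); split => // u ut.
    by rewrite /mix /= in_cons (negbTE ut).
  suff E : mix (mem (t :: l)) y x = mix (mem l) y x.
    by rewrite E subrr normr0 ltxx in d0.
  apply: funext => u; rewrite /mix /= in_cons.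
  by have [->|//] := eqVneq u t; rewrite xyt; case: ifP.
rewrite -(mixE s)//; apply: sP => t ts.
by rewrite /mix /= ts.
Qed.

Section points.
Context (h : T -> nat -> bool) (hinj : injective h).

(** As [k] and [c] vary, these points form a countable dense subset of the cube. *)
Definition bits_point k (c : {ffun {ffun 'I_k -> bool} -> bool}) :
  cantor_cube T :=
  fun t => c (bits h k t).

Lemma bits_point_dense (s : seq T) :
  exists k, forall x, exists c : {ffun _ -> bool},
  {in s, forall t, @bits_point k c t = x t}.
Proof.
have [k /(_ _ (leqnn k)) inj] := bits_inj_on s hinj.
exists k => x; exists [ffun w => has (fun t => (bits h k t == w) && x t) s].
move=> t ts; rewrite /bits_point ffunE.
apply/hasP/idP => [[u us /andP[/eqP ut]]|xt].
  by rewrite (inj u t).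
by exists t => //; rewrite eqxx.
Qed.

(* A piece [B `&` bits h k @^-1` [set w]] may carry a large oscillation of [f]
   without containing an active coordinate, but for large [k] the pieces
   separate the finitely many coordinates that matter up to [m.+1%:R^-1]. *)
Lemma active_hit f e (B : set T) : continuous f -> 0 < e ->
  active e f `&` B !=set0 <->
  exists m : nat, forall k, exists (w : {ffun 'I_k -> bool}) j
    (c d : {ffun {ffun 'I_j -> bool} -> bool}),
    e + m.+1%:R^-1 <
      `|f (bits_point c) - f (mix (fun t => (t \in B) && (bits h k t == w))
                                  (bits_point d) (bits_point c))|.
Proof.
move=> cf e0; split.
  move=> [t [[x [y [xy exy]]] Bt]].
  (* The excess over [e] is split in three: two approximations by points of the dense set, and the
     margin. *)
  pose dl := (`|f x - f y| - e) / 3.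
  have dl0 : 0 < dl by rewrite divr_gt0// subr_gt0.
  have [m mdl] := exists_invS_lt dl0.
  exists m => k; exists (bits h k t).
  have [s sP] := cantor_cube_unif cf dl0.
  have [j jP] := bits_point_dense s.
  have [[c cx] [d dy]] := (jP x, jP y).
  exists j, c, d.
  set z := mix _ _ _.
  have fx : `|f x - f (bits_point c)| < dl by apply: sP => u us; rewrite cx.
  have fy : `|f y - f z| < dl.
    apply: sP => u us; rewrite /z /mix; case: ifPn => [_|]; first by rewrite dy.
    have [->|ut _] := eqVneq u t; first by rewrite eqxx andbT mem_set.
    by rewrite cx// xy.
  have : `|f x - f y| <=
      `|f x - f (bits_point c)| + `|f (bits_point c) - f z| + `|f y - f z|.
    rewrite [f x - f y](_ : _ = f x - f (bits_point c) +
      (f (bits_point c) - f z) - (f y - f z)).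
      by apply: le_trans (ler_normB _ _) _; rewrite lerD2r ler_normD.
    by ring.
  have : `|f x - f y| = dl * 3 + e by rewrite divfK ?subrK// pnatr_eq0.
  by move: mdl fx fy; move: (m.+1%:R^-1) => r; clearbody dl; lra.
move=> [m mP]; have e20 : 0 < m.+1%:R^-1 :> R by rewrite invr_gt0 ltr0n.
have [s sP] := cantor_cube_unif cf e20.
have [k /(_ _ (leqnn k)) inj] := bits_inj_on s hinj.
have [w [j [c [d]]]] := mP k.
set b := fun t => _; set x := bits_point c; set y := mix b _ _ => exy.
(* [y'] differs from [x] only at coordinates of [s] in one piece of [B]; by [inj] there is at most
   one, and it is active because the margin absorbs the change from [y] to [y']. *)
pose y' := mix (mem s) y x.
have fy : `|f y - f y'| < m.+1%:R^-1.
  by apply: sP => t ts; rewrite /y' /mix/= ts.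
have xy' : e < `|f x - f y'|.
  have : `|f x - f y| <= `|f x - f y'| + `|f y - f y'|.
    rewrite [f x - f y](_ : _ = f x - f y' - (f y - f y')) ?ler_normB//; ring.
  move: exy fy; move: (m.+1%:R^-1) => r; lra.
have [[t /andP[bt ts]]|nt] := pselect (exists t, b t && (t \in s)).
  exists t; split; last by move: bt => /andP[/set_mem].
  exists x, y'; split => // u ut; rewrite /y' /mix/=; case: ifP => // us.
  rewrite /y /mix; case: ifP => // bu; case/negP: ut; apply/eqP/inj => //.
  by move: bt bu => /andP[_ /eqP ->] /andP[_ /eqP ->].
exfalso; suff E : x = y'.
  by move: xy'; rewrite -E subrr normr0 ltNge ltW.
apply: funext => u; rewrite /y' /mix/=; case: ifP => // us.
by rewrite /y /mix; case: ifP => // bu; case: nt; exists u; rewrite bu.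
Qed.

End points.
End cantor_cube.

(** * Countable coding of approximants, and measurability of uniformly open sets *)

Section code.
Context (T : eqType) (h : T -> nat -> bool).

(* For finite [A] separated by [bits h k], [code k A x] encodes [x] restricted
   to [A] in a countable type independent of [A]. *)
Definition code k (A : set T) (x : cantor_cube T) :
  {ffun {ffun 'I_k -> bool} -> bool} :=
  [ffun w => `[< exists t, [/\ A t, bits h k t = w & x t] >]].

Lemma eq_code k (A : set T) x y : (forall t, A t -> x t = y t) ->
  code k A x = code k A y.
Proof.
move=> xy; apply/ffunP => w; rewrite !ffunE; apply: asbool_equiv_eq.
by split=> -[t [At tw xt]]; exists t; split => //; rewrite ?xy// -xy.
Qed.

Lemma bits_point_code k (s : seq T) x t :
  {in s &, injective (bits h k)} -> t \in s ->
  bits_point h (code k [set` s] x) t = x t.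
Proof.
move=> inj ts; rewrite /bits_point ffunE.
apply/asboolP/idP => [[u [us ut xu]]|xt]; last by exists t.
by rewrite -(inj u t).
Qed.

End code.

Lemma exists_rat_near (R : realType) (e r : R) : 0 < e ->
  exists q : rat, `|r - ratr q| < e.
Proof.
move=> e0; have [|q] := @rat_in_itvoo R (r - e) (r + e).
  by rewrite ltrD2l gtrN.
by exists q; rewrite distrC ltr_distl.
Qed.

Lemma sigma_algebra_unif_open (R : realType) (T : eqType) (le : rel T)
    (S : set (set (continuousType (cantor_cube T) R)))
    (U : set (continuousType (cantor_cube T) R)) :
  is_omega1 le -> sigma_algebra setT S ->
  (forall (x y : cantor_cube T) r, S [set f | r < `|f x - f y|]) ->
  (forall (x : cantor_cube T) a r, S [set f | `|f x - a| <= r]) ->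
  (forall f, U f -> exists2 d : R, 0 < d & forall g : continuousType _ R,
    (forall x, `|f x - g x| <= d) -> U g) ->
  S U.
Proof.
move=> o1 sS S2 S1 Uopen.
have [h hinj] := omega1_reals o1.
have cts (f : continuousType (cantor_cube T) R) : continuous f by exact: cts_fun.
have n0 n : 0 < n.+1%:R^-1 :> R by rewrite invr_gt0 ltr0n.
have Sactive n (P : set T -> Prop) :
    S [set f : continuousType _ _ | P (active n.+1%:R^-1 f)].
  apply: (@sigma_algebra_hit _ S _ le
      (fun f : continuousType _ _ => active n.+1%:R^-1 f)) => // [f|B].
    exact: active_finite.
  rewrite (_ : mkset _ = [set f : continuousType _ _ |
    exists m : nat, forall k, exists (w : {ffun 'I_k -> bool}) j
    (c d : {ffun {ffun 'I_j -> bool} -> bool}),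
    n.+1%:R^-1 + m.+1%:R^-1 < `|f (bits_point h c) -
      f (mix (fun t => (t \in B) && (bits h k t == w))
             (bits_point h d) (bits_point h c))|]).
    apply: sigma_algebra_ex => // m; apply: sigma_algebra_all => // k.
    do 4!apply: sigma_algebra_ex => // ?.
    exact: S2.
  by apply/funext => f; apply/propext/(active_hit hinj B (cts f) (n0 n)).
pose near j (g : cantor_cube T -> R) (Phi : cantor_cube T -> R) :=
  forall x, `|g x - Phi x| <= j.+1%:R^-1.
pose Phi k (psi : {ffun {ffun {ffun 'I_k -> bool} -> bool} -> rat}) A x : R :=
  ratr (psi (code h k A x)).
pose good k psi j (A : set T) :=
  forall g : continuousType _ _, near j g (@Phi k psi A) -> U g.
rewrite (_ : U = [set f | exists n k
    (psi : {ffun {ffun {ffun 'I_k -> bool} -> bool} -> rat}) j,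
    good k psi j (active n.+1%:R^-1 f) /\
    forall i (c : {ffun {ffun 'I_i -> bool} -> bool}),
      exists v, code h k (active n.+1%:R^-1 f) (bits_point h c) = v /\
        `|f (bits_point h c) - ratr (psi v)| <= j.+1%:R^-1]).
  apply: sigma_algebra_ex => // n; apply: sigma_algebra_ex => // k.
  apply: sigma_algebra_ex => // psi; apply: sigma_algebra_ex => // j.
  apply: sigma_algebra_and => //.
  do 2!apply: sigma_algebra_all => // ?.
  (* For fixed [v], the first condition concerns only the active set and the second only one
     evaluation of [f]. *)
  apply: sigma_algebra_ex => // v; apply: sigma_algebra_and; [by []| |exact: S1].
  exact: (Sactive _ (fun A => code h _ A _ = v)).
apply/seteqP; split=> [f Uf|f [n [k [psi [j [fgood fnear]]]]]]; last first.
  apply: fgood => x; apply/ler_addgt0Pr => e e0.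
  have [s sP] := cantor_cube_unif (cts f) e0.
  have /finite_seqP[a aE] := active_finite (cts f) (n0 n).
  (* Agreement on [a] preserves the code, and agreement on [s] moves [f] by less than [e]; so the
     bound on the dense set extends to [x]. *)
  have [i iP] := bits_point_dense hinj (s ++ a).
  have [c cx] := iP x.
  have [v [vE vj]] := fnear _ c.
  rewrite /Phi (_ : code _ _ _ x = v); last first.
    rewrite -vE; apply: eq_code => t At; rewrite cx// mem_cat; apply/orP; right.
    by move: At; rewrite aE.
  rewrite (_ : f x - _ = (f (bits_point h c) - ratr (psi v)) +
    (f x - f (bits_point h c))); last by ring.
  rewrite (le_trans (ler_normD _ _))// lerD// ltW// sP// => t ts.
  by rewrite cx// mem_cat ts.
have [d d0 dU] := Uopen _ Uf.
(* Half of [d], since [f] and [g] are both compared with the same approximant. *)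
have [j jd] : exists j, j.+1%:R^-1 < d / 2.
  by apply: exists_invS_lt; rewrite divr_gt0.
pose e : R := j.+1%:R^-1.
(* One half of [e] pays for decoding [x] from its code, the other for rounding the value to a
   rational. *)
have e20 : 0 < e / 2 by rewrite divr_gt0// invr_gt0 ltr0n.
have [n nP] := active_determines (cts f) e20.
have /finite_seqP[a aE] := active_finite (cts f) (n0 n).
have [k /(_ _ (leqnn k)) inj] := bits_inj_on a hinj.
have /choice[q qP] : forall r : R, exists q : rat, `|r - ratr q| < e / 2.
  by move=> r; exact: exists_rat_near.
pose psi : {ffun {ffun {ffun 'I_k -> bool} -> bool} -> rat} :=
  [ffun v => q (f (bits_point h v))].
have fnear : near j f (Phi k psi (active n.+1%:R^-1 f)).
  move=> x; rewrite /Phi ffunE; set y := bits_point h _.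
  rewrite (_ : f x - _ = (f x - f y) + (f y - ratr (q (f y)))); last by ring.
  rewrite (le_trans (ler_normD _ _))// -/e (splitr e) lerD// ltW// nP// => t.
  by rewrite /y aE => /= ta; rewrite bits_point_code.
exists n, k, psi, j; split=> [g gnear|i c]; last first.
  exists (code h k (active n.+1%:R^-1 f) (bits_point h c)).
  by split; [|exact: fnear].
apply: dU => x.
rewrite (_ : f x - g x = (f x - Phi k psi (active n.+1%:R^-1 f) x) -
  (g x - Phi k psi (active n.+1%:R^-1 f) x)); last by ring.
by rewrite (le_trans (ler_normB _ _))// (splitr d) lerD// (le_trans _ (ltW jd)).
Qed.

(** * Comparison of the pointwise and norm topologies and of their sigma-algebras *)

Lemma Cptws_eval_continuous (R : realType) (T : topologicalType) (x : T) :
  continuous (fun f : Cptws R T => (f : continuousType T R) x : R).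
Proof.
move=> f; apply: (@continuous_comp (Cptws R T) {ptws T -> R} R
  (fun g => (g : continuousType T R) : T -> R) (fun u => u x)).
  exact: (@initial_continuous _ _ (id : continuousType T R -> {ptws T -> R}) f).
exact: (@proj_continuous T (fun=> R) x).
Qed.

Lemma Cnorm_Cptws_continuous (R : realType) (K : topologicalType)
    (cK : compact [set: K]) : continuous (id : Cnorm R cK -> Cptws R K).
Proof.
apply: continuous_comp_initial => f.
apply/(@pointwise_cvgP K R _ (f : continuousType K R)).
  exact: (@fmap_filter _ _ _ _ (nbhs_filter f)).
move=> x.
suff cx : (fun g : Cnorm R cK => Cnorm_fun g x) @ f --> Cnorm_fun f x by exact: cx.
move=> V /nbhs_normP[e /= e0 eV].
apply/(@nbhs_normP R (Cnorm R cK) f); exists e => //= g fg.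
by apply: eV => /=; apply: le_lt_trans fg; exact: (le_sup_norm (f - g) x).
Qed.

Lemma baire_sigma_preimage (R : realType) (X : topologicalType)
    (F : X -> R) (Y : set R) :
  continuous F -> measurable Y -> baire_sigma R X (F @^-1` Y).
Proof.
move=> cF mY; apply: sub_sigma_algebra; exists F => //.
by exists Y => //; rewrite setTI.
Qed.

Lemma borel_sigma_preimage (R : realType) (X : topologicalType)
    (F : X -> R) (Y : set R) :
  continuous F -> measurable Y -> borel_sigma X (F @^-1` Y).
Proof.
move=> /continuousP cF.
rewrite [X in X Y -> _](measurable_realfun.RGenOpens.measurableE R) => mY.
(* The sets with Borel preimage form a sigma-algebra, so it suffices to treat the generating open
   intervals. *)
suff: image_set_system setT F (borel_sigma X) Y.
  by rewrite /image_set_system /= setTI.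
apply: mY; split; first exact/sigma_algebra_image/smallest_sigma_algebra.
move=> _ [a [b ->]]; rewrite /image_set_system /= setTI.
by apply: sub_sigma_algebra; apply: cF; exact: interval_open.
Qed.

(* [Cptws] and [Cnorm] have the same underlying set of continuous functions, so
   both sides are families of subsets of that set. *)
Theorem theorem3p6 (R : realType) (T : eqType) (le : rel T)
    (omega1_T : is_omega1 le) :
  baire_sigma R (Cptws R (cantor_cube T)) = borel_sigma (Cnorm R (@cantor_cube_compact T))
    :> set (set (continuousType (cantor_cube T) R)).
Proof.
apply/seteqP; split; apply: smallest_sub; try exact: smallest_sigma_algebra.
  (* The norm topology is finer, so a function continuous for pointwise convergence is norm
     continuous. *)
  move=> _ [F cF [Y mY <-]]; rewrite setTI.
  apply: (@borel_sigma_preimage R (Cnorm R (@cantor_cube_compact T)) F) => // f.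
  apply: (@continuous_comp (Cnorm R _) (Cptws R (cantor_cube T)) R id F).
    exact: Cnorm_Cptws_continuous.
  exact: cF.
move=> U oU.
have cE x := @Cptws_eval_continuous R (cantor_cube T) x.
apply: (sigma_algebra_unif_open omega1_T).
- exact: smallest_sigma_algebra.
- move=> x y r.
  apply: (@baire_sigma_preimage R (Cptws R (cantor_cube T))
    (fun f => `|(f : continuousType _ _) x - (f : continuousType _ _) y|) [set z | r < z]).
    by move=> f; exact: (cvg_norm (cvgB (cE x f) (cE y f))).
  by rewrite -set_itvoy.
- move=> x a r.
  apply: (@baire_sigma_preimage R (Cptws R (cantor_cube T))
    (fun f => `|(f : continuousType _ _) x - a|) [set z | z <= r]).
    by move=> f; exact: (cvg_norm (cvgB (cE x f) (@cvg_cst _ a _ _ _))).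
  by rewrite -set_itvNyc.
- move=> f Uf.
  have : nbhs (f : Cnorm R (@cantor_cube_compact T)) U by exact: open_nbhs_nbhs.
  (* The radius is halved because a pointwise bound gives only a non-strict bound on the supremum,
     while the norm ball is open. *)
  move=> /nbhs_normP[e /= e0 eU]; exists (e / 2); first by rewrite divr_gt0.
  move=> g fg; apply: eU => /=; rewrite (@le_lt_trans _ _ (e / 2))//; last by lra.
  by apply: sup_norm_le => //; rewrite divr_ge0// ltW.
Qed.
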